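(* Let $(G,\mathcal{H})$ be a relatively hyperbolic pair with $\mathcal{H}$ nonempty and every peripheral subgroup $H\in\mathcal{H}$ infinite. Then there exist proper hyperbolic spaces $X_1$ and $X_2$, each equipped with a geometrically finite action of $G$ for which $\mathcal{H}$ consists of exactly the maximal parabolic subgroups, such that there is no $G$-equivariant quasi-isometry $X_1\to X_2$.
   Context: All actions on metric spaces are by isometries. A hyperbolic space is a geodesic metric space that is hyperbolic in the sense of Gromov; it is proper if closed balls are compact; $\partial X$ denotes the Gromov boundary. An action $G\curvearrowright M$ on a compact metrizable space $M$ is a convergence action if the induced action on the set of distinct triples $\{(m_1,m_2,m_3)\mid m_i\in M,\ m_i\ne m_j \text{ for } i\neq j\}$ is properly discontinuous. A convergence action is geometrically finite if every $m\in M$ satisfies one of the following: (1) $m$ is a bounded parabolic point, meaning it has infinite stabilizer acting cocompactly on $M\setminus\{m\}$; (2) $m$ is a conical limit point, meaning there exist a sequence $(g_i)_{i\in\mathbb{N}}$ of group elements and distinct points $a,b\in M$ such that $g_i m\to a$ and $g_i m'\to b$ for all $m'\ne m$. An action of $G$ on a proper hyperbolic space $X$ is called geometrically finite if it is properly discontinuous and its induced action on $\partial X$ is a geometrically finite convergence action. A parabolic subgroup is an infinite subgroup of $G$ that fixes a point of $\partial X$ and contains no loxodromic elements; a maximal parabolic subgroup is one maximal with respect to inclusion. A pair $(G,\mathcal{H})$, where $\mathcal{H}$ is a set of subgroups of $G$ (the peripheral subgroups), is relatively hyperbolic if $G$ admits a geometrically finite action on a proper hyperbolic space $X$ such that $\mathcal{H}$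 consists of exactly the maximal parabolic subgroups and each of these is finitely generated. *)

(* Defs.v *)
From HB Require Import structures.
From mathcomp Require Import all_boot all_order all_algebra.
From mathcomp Require Import all_classical all_reals all_analysis.

Set Implicit Arguments.
Unset Strict Implicit.
Unset Printing Implicit Defensive.

Import Order.TTheory GRing.Theory Num.Theory.
Import numFieldNormedType.Exports.

Local Open Scope classical_set_scope.
Local Open Scope ring_scope.

Definition is_subgroup (G : groupType) (H : set G) : Prop :=
  group_closed [in H].

Definition finitely_generated (G : groupType) (H : set G) : Prop :=
  exists2 S : set G, finite_set S & smallest (@is_subgroup G) S = H.

Definition zpow (G : groupType) (g : G) (n : int) : G :=
  match n with Posz k => (g ^+ k)%g | Negz k => (g ^- k.+1)%g end.

Record action (G : groupType) (T : Type) := Action {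
  act :> G -> T -> T ;
  act1 : forall x, act 1%g x = x ;
  actM : forall g h x, act (g * h)%g x = act g (act h x)
}.

Record isom_action (R : realType) (G : groupType) (X : metricType R) :=
  IsomAction {
    isom_act :> action G X ;
    isom_actE : forall g x y, mdist (isom_act g x) (isom_act g y) = mdist x y
  }.

Definition stabilizer (G : groupType) (T : Type) (a : action G T) (m : T) :
  set G := [set g | a g m = m].

(* The action induced on an invariant subset [A] of [T]; a subset of [A] is
   compact in the subspace topology iff it is compact in [T]. *)
Definition properly_discontinuous_on (G : groupType) (T : topologicalType)
    (a : G -> T -> T) (A : set T) : Prop :=
  forall K, K `<=` A -> compact K ->
    finite_set [set g | (a g @` K) `&` K !=set0].

Definition cocompact_on (G : groupType) (T : topologicalType)
    (H : set G) (a : G -> T -> T) (A : set T) : Prop :=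
  exists K, [/\ compact K, K `<=` A & A = \bigcup_(h in H) (a h @` K)].

Section MetricSpaces.
Context {R : realType}.

(* Stated for bare distance functions, so that it also applies to [int]. *)
Definition qi_embedding (A B : Type) (dA : A -> A -> R) (dB : B -> B -> R)
    (f : A -> B) : Prop :=
  exists K C : R, [/\ 1 <= K, 0 <= C &
    forall x y, K^-1 * dA x y - C <= dB (f x) (f y) <= K * dA x y + C].

Definition quasi_isometry (X Y : metricType R) (f : X -> Y) : Prop :=
  qi_embedding mdist mdist f /\
  exists D : R, forall y, exists x, mdist (f x) y <= D.

Definition equivariant (G : groupType) (S T : Type)
    (a : action G S) (b : action G T) (f : S -> T) : Prop :=
  forall g x, f (a g x) = b g (f x).

Context {X : metricType R}.

Definition gromov_product (o x y : X) : R :=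
  (mdist o x + mdist o y - mdist x y) / 2.

Definition gromov_hyperbolic : Prop :=
  exists delta : R, forall o x y z,
    Num.min (gromov_product o x y) (gromov_product o y z) - delta
      <= gromov_product o x z.

Definition geodesic_space : Prop :=
  forall x y, exists c : R -> X, [/\ c 0 = x, c (mdist x y) = y &
    {in `[0, mdist x y] &, forall s t, mdist (c s) (c t) = `|s - t|}].

Definition proper_space : Prop :=
  forall (x : X) (r : R), compact [set y | mdist x y <= r].

End MetricSpaces.
Arguments gromov_hyperbolic {R} X.
Arguments geodesic_space {R} X.
Arguments proper_space {R} X.

Definition proper_hyperbolic_space (R : realType) (X : metricType R) : Prop :=
  [/\ geodesic_space X, gromov_hyperbolic X & proper_space X].

(* A geodesic ray is an isometric embedding of [0, +oo); the values of [c] at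
   negative arguments are irrelevant, and identified by [asymptotic]. *)
Record ray (R : realType) (X : metricType R) := Ray {
  ray_fun :> R -> X ;
  rayP : forall s t, 0 <= s -> 0 <= t ->
    mdist (ray_fun s) (ray_fun t) = `|s - t|
}.

HB.instance Definition _ (R : realType) (X : metricType R) :=
  gen_eqMixin (ray X).
HB.instance Definition _ (R : realType) (X : metricType R) :=
  gen_choiceMixin (ray X).

Section GromovBoundary.
Context {R : realType}.
Variable X : metricType R.
Local Open Scope quotient_scope.
Implicit Types (c : ray X) (o : X).

Definition asymptotic c c' : bool :=
  `[< exists D : R, forall t, 0 <= t -> mdist (c t) (c' t) <= D >].

Lemma asymptotic_equiv : equiv_class_of asymptotic.
Proof.
split.
- by move=> c; apply/asboolP; exists 0 => t _; rewrite mdistxx.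
- move=> c c'; apply/asboolP/asboolP => -[D cD]; exists D => t t0;
    by rewrite metric_sym cD.
- move=> c1 c2 c3 /asboolP[D cD] /asboolP[D' cD']; apply/asboolP.
  exists (D + D') => t t0.
  by rewrite (le_trans (metric_triangle _ (c1 t) _))// lerD ?cD ?cD'.
Qed.

Canonical asymptotic_equiv_rel := EquivRelPack asymptotic_equiv.

Definition boundary : Type := {eq_quot asymptotic_equiv_rel}.

HB.instance Definition _ := Choice.on boundary.

Definition ray_end (c : ray X) : boundary :=
  \pi_({eq_quot asymptotic_equiv_rel}) c.

Definition ray_of (xi : boundary) : ray X :=
  repr (xi : {eq_quot asymptotic_equiv_rel}).

Lemma ray_ofK xi : ray_end (ray_of xi) = xi.
Proof. exact: reprK. Qed.

Lemma ray_endP c c' : ray_end c = ray_end c' <->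
  exists D : R, forall t, 0 <= t -> mdist (c t) (c' t) <= D.
Proof.
split=> [/eqP|]; first by rewrite eqmodE => /asboolP.
by move=> /asboolP cc'; apply/eqP; rewrite eqmodE.
Qed.

(* The basic neighbourhood of [xi] seen from [o]: the points [eta] such that
   some rays [c] to [xi] and [c'] to [eta], both issued from [o], satisfy
   liminf_t (c t | c' t)_o >= r. *)
Definition shadow (o : X) (xi : boundary) (r : R) : set boundary :=
  [set eta | exists c c' : ray X,
    [/\ c 0 = o, c' 0 = o, ray_end c = xi, ray_end c' = eta &
        (r%:E <= limf_einf
           (fun t : R => (gromov_product o (c t) (c' t))%:E) +oo%R)%E]].

(* On a proper hyperbolic space the shadows seen from different base points
   define the same topology; quantifying over [o] avoids choosing one. *)
Definition boundary_open (U : set boundary) : Prop :=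
  forall o xi, U xi -> exists r : R, shadow o xi r `<=` U.

Lemma shadow_le o xi r r' : r <= r' -> shadow o xi r' `<=` shadow o xi r.
Proof.
move=> rr' eta [c [c' [c0 c'0 cxi ceta h]]]; exists c, c'; split=> //.
by apply: le_trans h; rewrite lee_fin.
Qed.

Lemma boundary_openT : boundary_open setT.
Proof. by move=> o xi _; exists 0. Qed.

Lemma boundary_openI : setI_closed boundary_open.
Proof.
move=> U V oU oV o xi [/(oU o)[r rU] /(oV o)[s sV]].
exists (Num.max r s) => eta h; split.
  by apply: rU; apply: shadow_le h; rewrite le_max lexx.
by apply: sV; apply: shadow_le h; rewrite le_max lexx orbT.
Qed.

Lemma boundary_open_bigU (I : Type) (f : I -> set boundary) :
  (forall i, boundary_open (f i)) -> boundary_open (\bigcup_i f i).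
Proof.
move=> of_ o xi [i _ /(of_ i o)[r rf]].
by exists r => eta /rf ?; exists i.
Qed.

HB.instance Definition _ := isOpenTopological.Build boundary
  boundary_openT boundary_openI boundary_open_bigU.

End GromovBoundary.

Lemma boundary_openE (R : realType) (X : metricType R) :
  @open (boundary X) = @boundary_open R X.
Proof. by []. Qed.

Section BoundaryAction.
Context {R : realType} {G : groupType} {X : metricType R}.
Variable a : isom_action G X.

Lemma push_ray_subproof g (c : ray X) s t : 0 <= s -> 0 <= t ->
  mdist (a g (c s)) (a g (c t)) = `|s - t|.
Proof. by move=> s0 t0; rewrite isom_actE rayP. Qed.

Definition push_ray g (c : ray X) : ray X := Ray (push_ray_subproof g c).

Definition boundary_map g (xi : boundary X) : boundary X :=
  ray_end (push_ray g (ray_of xi)).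

Lemma boundary_mapE g c : boundary_map g (ray_end c) = ray_end (push_ray g c).
Proof.
apply/ray_endP; have /ray_endP[D cD] := ray_ofK (ray_end c).
by exists D => t t0; rewrite isom_actE cD.
Qed.

Lemma boundary_map1 xi : boundary_map 1%g xi = xi.
Proof.
rewrite -[xi]ray_ofK boundary_mapE; apply/ray_endP.
by exists 0 => t _; rewrite /= act1 mdistxx.
Qed.

Lemma boundary_mapM g h xi :
  boundary_map (g * h)%g xi = boundary_map g (boundary_map h xi).
Proof.
rewrite -[xi]ray_ofK !boundary_mapE; apply/ray_endP.
by exists 0 => t _; rewrite /= actM mdistxx.
Qed.

Definition boundary_action : action G (boundary X) :=
  Action boundary_map1 boundary_mapM.

End BoundaryAction.

Section ConvergenceActions.
Variable R : realType.
Context {G : groupType} {M : topologicalType}.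
Variable a : action G M.

Definition metrizable (T : topologicalType) : Prop :=
  exists (N : metricType R) (f : T -> N) (g : N -> T),
    [/\ cancel f g, cancel g f, continuous f & continuous g].

Definition distinct_triples : set (M * M * M) :=
  [set t | [/\ t.1.1 <> t.1.2, t.1.1 <> t.2 & t.1.2 <> t.2]].

Definition act_triple (g : G) (t : M * M * M) : M * M * M :=
  (a g t.1.1, a g t.1.2, a g t.2).

Definition convergence_action : Prop :=
  [/\ compact [set: M], metrizable M, forall g, continuous (a g) &
      properly_discontinuous_on act_triple distinct_triples].

Definition bounded_parabolic_point (m : M) : Prop :=
  infinite_set (stabilizer a m) /\
  cocompact_on (stabilizer a m) a (~` [set m]).

Definition conical_limit_point (m : M) : Prop :=
  exists (g : nat -> G) (p q : M), [/\ p <> q,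
    (fun i => a (g i) m) @ \oo --> p &
    forall m', m' <> m -> (fun i => a (g i) m') @ \oo --> q].

Definition geometrically_finite_convergence : Prop :=
  convergence_action /\
  forall m, bounded_parabolic_point m \/ conical_limit_point m.

End ConvergenceActions.

Section GeometricallyFinite.
Context {R : realType} {G : groupType} {X : metricType R}.
Variable a : isom_action G X.

Definition geometrically_finite : Prop :=
  properly_discontinuous_on a [set: X] /\
  geometrically_finite_convergence R (boundary_action a).

Definition loxodromic (g : G) : Prop :=
  exists x : X, qi_embedding (fun m n : int => `|m%:~R - n%:~R|) mdist
    (fun n : int => a (zpow g n) x).

Definition parabolic (P : set G) : Prop :=
  [/\ is_subgroup P, infinite_set P,
      exists xi, forall g, P g -> boundary_action a g xi = xi &
      forall g, P g -> ~ loxodromic g].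

Definition maximal_parabolic (P : set G) : Prop :=
  parabolic P /\ forall Q, parabolic Q -> P `<=` Q -> Q = P.

End GeometricallyFinite.

Definition relatively_hyperbolic (R : realType) (G : groupType)
    (HH : set (set G)) : Prop :=
  exists (X : metricType R) (a : isom_action G X),
    [/\ proper_hyperbolic_space X, geometrically_finite a,
        HH = [set P | maximal_parabolic a P] &
        forall H, HH H -> finitely_generated H].

(* Main.v *)
Require Import Defs.
From HB Require Import structures.
From mathcomp Require Import all_boot all_order all_algebra.
From mathcomp Require Import all_classical all_reals all_analysis.
From mathcomp Require Import finmap lra ring.

(* Take X_1 to be any space X witnessing relative hyperbolicity, and obtain X_2
   from X by gluing a segment of finite length ("hair") at each point of a
   locally finite G-invariant set.  Finite hairs change neither the geodesic
   and Gromov hyperbolic nature of X, nor its boundary, nor which elements are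
   loxodromic; local finiteness keeps the space proper.

   The action on X is not cobounded: an element p of a parabolic group fixing
   the end of a ray c moves c(t), for t large, by at most a constant depending
   only on the hyperbolicity constant, so if the points c(t) could be translated
   into a fixed ball, conjugates of arbitrarily many elements of the group would
   move a base point by a bounded amount, against proper discontinuity.
   Hence there are points x_n at distance more than n + 1 from the orbit of the
   base point.  Attach hairs of length at least n at the translates of N_n + 1
   points of the unit ball around x_n, where N_n bounds the size of the
   1-separated subsets of a huge ball of X around the base point.  A
   quasi-isometry from X to the result would provide, for n large, N_n + 1
   preimages of the tips of these hairs, 1-separated and in that ball. *)

Set Implicit Arguments.
Unset Strict Implicit.
Unset Printing Implicit Defensive.

Import Order.TTheory GRing.Theory Num.Theory.
Import numFieldNormedType.Exports.

Local Open Scope classical_set_scope.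
Local Open Scope ring_scope.

(** * Hyperbolicity as a four-point condition *)

Definition four_point (R : realType) (X : metricType R) (d : R)
    (x y z w : X) : Prop :=
  mdist x z + mdist y w <=
    d + Num.max (mdist x y + mdist z w) (mdist y z + mdist w x).

(** The four points are the corners of a quadrilateral, with the diagonals on the left and the pairs
    of opposite sides on the right. The inequality is the one on Gromov products at [w], multiplied
    by 2, which accounts for the change of constant. *)
Lemma gromov_hyperbolicP (R : realType) (X : metricType R) :
  gromov_hyperbolic X <-> exists d : R, forall x y z w : X,
    four_point d x y z w.
Proof.
split=> [[d hd]|[d hd]].
  exists (2 * d) => x y z w; have := hd w x y z.
  rewrite /four_point /gromov_product.
  rewrite /Num.min /Num.max; case: ifP; case: ifP;
    rewrite (metric_sym y w) (metric_sym z w); lra.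
exists (d / 2) => o x y z; have := hd x y z o.
rewrite /four_point /gromov_product.
rewrite /Num.min /Num.max; case: ifP; case: ifP;
  rewrite (metric_sym y o) (metric_sym z o); lra.
Qed.

Lemma zpowDn (G : groupType) (g : G) (n : int) (k : nat) :
  zpow g (n + k%:Z) = (zpow g n * g ^+ k)%g.
Proof.
elim: k => [|k IHk]; first by rewrite addr0 expg0 mulg1.
have -> : n + k.+1%:Z = (n + k%:Z) + 1 by rewrite -addn1 PoszD addrA.
rewrite expgSr mulgA -IHk.
case: (n + k%:Z) => [m|m] /=; first by rewrite addn1 expgSr.
case: m => [|m] /=; first by rewrite expg1 mulVg.
rewrite (expgS g m.+1) invgM mulgVK.
by rewrite subn1.
Qed.

(** * Displacement of parabolic elements along a ray to their fixed point *)

Section Displacement.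
Context {R : realType} {G : groupType} {X : metricType R}.
Variable a : isom_action G X.

Lemma isom_inv g x y : mdist (a g^-1%g x) y = mdist x (a g y).
Proof. by rewrite -(isom_actE a g) -actM mulgV act1. Qed.

Lemma mdist_expg_le g x k : mdist x (a (g ^+ k)%g x) <= k%:R * mdist x (a g x).
Proof.
elim: k => [|k IHk]; first by rewrite expg0 act1 mdistxx mul0r.
rewrite expgSr actM (le_trans (metric_triangle _ (a (g ^+ k)%g x) _))//.
by rewrite isom_actE -natr1 mulrDl mul1r lerD.
Qed.

(** Nonnegative powers suffice, as the distance between two points of the orbit depends only on the
    difference of the exponents. *)
Lemma linear_growth_loxodromic g x :
  (forall k : nat, k%:R <= mdist x (a (g ^+ k)%g x)) -> loxodromic a g.
Proof.
move=> gx; exists x, (Num.max 1 (mdist x (a g x))), 0.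
have K1 : 1 <= Num.max 1 (mdist x (a g x)) by rewrite le_max lexx.
split=> // m n; wlog mn : m n / m <= n => [H|].
  have [/H//|/ltW/H] := leP m n.
  by rewrite (distrC m%:~R) (metric_sym (a (zpow g m) x)).
have [k ->] : exists k : nat, n = m + k%:Z.
  by exists `|n - m|%N; rewrite gez0_abs ?subr_ge0// [RHS]addrC subrK.
rewrite zpowDn actM isom_actE subr0 addr0.
have -> : `|m%:~R - (m + k%:Z)%:~R : R| = k%:R.
  by rewrite rmorphD/= opprD addrA subrr sub0r normrN -pmulrn normr_nat.
apply/andP; split.
  apply: le_trans (gx k); rewrite ler_piMl//.
  by rewrite invf_le1// (lt_le_trans _ K1).
apply: le_trans (mdist_expg_le _ _ _) _; rewrite mulrC ler_wpM2r//.
by rewrite le_max lexx orbT.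
Qed.

Variable c : ray X.

(* A Busemann cocycle truncated at [T]: how much [p] moves [c t] away from the
   end of [c]. *)
Definition shift (p : G) (t T : R) : R := mdist (a p (c t)) (c T) - (T - t).

Lemma shift_homol p t t' T : 0 <= t <= t' -> shift p t T <= shift p t' T.
Proof.
move=> /andP[t0 tt']; rewrite /shift.
have := metric_triangle (a p (c t)) (a p (c t')) (c T).
rewrite isom_actE rayP ?(le_trans t0)// ler0_norm ?subr_le0//; lra.
Qed.

Lemma shift_antir p t T T' : 0 <= T <= T' -> shift p t T' <= shift p t T.
Proof.
move=> /andP[T0 TT']; rewrite /shift.
have := metric_triangle (a p (c t)) (c T) (c T').
rewrite (rayP c) ?(le_trans T0)// ler0_norm ?subr_le0//; lra.
Qed.

Lemma shiftM p q t s T : shift (p * q)%g t T <= shift q t s + shift p s T.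
Proof.
rewrite /shift actM.
have := metric_triangle (a p (a q (c t))) (a p (c s)) (c T).
rewrite isom_actE; lra.
Qed.

(** By [shiftM] the shifts add up, so that [p ^+ k] brings [c 0] closer to [c (k%:R * L)] by at
    least [k], and therefore moves it by at least [k]. *)
Lemma shift_loxodromic p (L : R) : 0 <= L ->
  (forall k : nat, shift p (k%:R * L) (k.+1%:R * L) <= -1) -> loxodromic a p.
Proof.
move=> L0 pL.
have sh k : shift (p ^+ k)%g 0 (k%:R * L) <= - k%:R.
  elim: k => [|k IHk].
    by rewrite expg0 /shift act1 mul0r mdistxx subrr oppr0.
  rewrite expgS; apply: le_trans (shiftM _ _ _ (k%:R * L) _) _.
  by rewrite -natr1 opprD lerD// natr1 pL.
apply: (@linear_growth_loxodromic _ (c 0)) => k.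
have kL : 0 <= k%:R * L by rewrite mulr_ge0.
have := sh k; rewrite /shift subr0.
have := metric_triangle (c 0) (a (p ^+ k)%g (c 0)) (c (k%:R * L)).
rewrite (rayP c)// sub0r normrN ger0_norm//; lra.
Qed.

Variable delta : R.
Hypothesis X_hyp : forall x y z w : X, four_point delta x y z w.

Lemma hyp_delta_ge0 : 0 <= delta.
Proof.
have := X_hyp (c 0) (c 0) (c 0) (c 0).
by rewrite /four_point !mdistxx !addr0 maxxx addr0.
Qed.

(** The sum of the two shifts compares the diagonals of the quadrilateral formed by [c t], [c T] and
    their images under [p] with its two sides of length [T - t]. The other two sides are at most
    [D], too short to matter in the four-point inequalities once [D + delta < T - t]. *)
Lemma shift_inv p D t T : 0 <= t <= T ->
  (forall s, 0 <= s -> mdist (a p (c s)) (c s) <= D) -> D + delta < T - t ->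
  - delta <= shift p t T + shift p^-1%g t T <= delta.
Proof.
move=> /andP[t0 tT] pD DT; have T0 := le_trans t0 tT.
have ctT : mdist (c t) (c T) = T - t.
  by rewrite rayP// distrC ger0_norm// subr_ge0.
have h1 := pD _ t0; have h2 := pD _ T0; have d0 := hyp_delta_ge0.
have pctT : mdist (a p (c t)) (a p (c T)) = T - t by rewrite isom_actE.
have e1 := metric_sym (c T) (c t).
have e2 := metric_sym (a p (c T)) (a p (c t)).
have e3 := metric_sym (c t) (a p (c t)).
have e4 := metric_sym (c T) (a p (c T)).
have e5 := metric_sym (a p (c T)) (c t).
have e6 := metric_sym (a p (c t)) (c T).
rewrite /shift isom_inv.
have := X_hyp (a p (c t)) (c t) (c T) (a p (c T)).
have := X_hyp (c T) (c t) (a p (c t)) (a p (c T)).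
have := X_hyp (c t) (a p (c t)) (c T) (a p (c T)).
rewrite /four_point /Num.max;
  case: ifP => _; case: ifP => _; case: ifP => _; lra.
Qed.

Definition fixes_end (p : G) := exists D : R,
  forall s, 0 <= s -> mdist (a p (c s)) (c s) <= D.

Lemma fixes_endV p : fixes_end p -> fixes_end p^-1%g.
Proof. by move=> [D pD]; exists D => s s0; rewrite isom_inv metric_sym pD. Qed.

(** An element with shift at most -1 at every step of length [L] would be loxodromic. At a step
    where this fails, [shift_inv] turns the lower bound for [p] into an upper bound for its
    inverse. *)
Lemma not_loxodromic_shift p : fixes_end p -> ~ loxodromic a p ->
  exists t0 T0 : R, 0 <= t0 <= T0 /\ shift p^-1%g t0 T0 <= 1 + delta.
Proof.
move=> [D pD] pnlox; pose L := Num.max 0 D + delta + 1.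
have d0 := hyp_delta_ge0.
have L0 : 0 <= L by rewrite /L /Num.max; case: ifP; lra.
have DL : D + delta < L by rewrite /L /Num.max; case: ifP; lra.
have [k hk] : exists k : nat, - 1 < shift p (k%:R * L) (k.+1%:R * L).
  apply: contrapT => /forallNP h; apply: pnlox; apply: (shift_loxodromic L0).
  by move=> k; rewrite leNgt; apply/negP.
have kk : k.+1%:R * L - k%:R * L = L by rewrite -mulrBl -natr1; ring.
exists (k%:R * L), (k.+1%:R * L).
have tT : 0 <= k%:R * L <= k.+1%:R * L.
  by rewrite mulr_ge0//= -subr_ge0 kk.
split=> //.
have /andP[_] := shift_inv tT pD ltac:(by rewrite kk).
lra.
Qed.

(** Upper bounds on the shifts of [p] and of its inverse say that the distances from [a p (c t)] to
    [c T] and to [c 0] exceed [T - t] and [t] by at most a constant. By the four-point condition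
    such a point is close to [c t]. *)
Lemma parabolic_displacement p : fixes_end p ->
  ~ loxodromic a p -> ~ loxodromic a p^-1%g ->
  exists2 t0 : R, 0 <= t0 & forall t, t0 <= t ->
    mdist (a p (c t)) (c t) <= 4 * delta + 1.
Proof.
move=> pfix pnlox pVnlox.
have d0 := hyp_delta_ge0.
have [s' [S' [/andP[s'0 sS'] hp']]] := not_loxodromic_shift pfix pnlox.
have [s [S []]] := not_loxodromic_shift (fixes_endV pfix) pVnlox.
rewrite invgK => /andP[s0 sS] hp.
case: (pfix) => D pD.
exists (Num.max S S'); first by rewrite le_max (le_trans s0).
move=> t; rewrite ge_max => /andP[St S't].
have t0 : 0 <= t by rewrite (le_trans s0)// (le_trans sS).
pose T := t + Num.max 0 D + delta + 1.
have tT : t <= T by rewrite /T /Num.max; case: ifP; lra.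
have DT : D + delta < T - t by rewrite /T /Num.max; case: ifP; lra.
have DT' : D + delta < T - s.
  apply: lt_le_trans DT _; lra.
have T0 := le_trans t0 tT.
(* The shift hardly depends on its arguments: it is monotone in both, with
   opposite monotonicity for the inverse. *)
have bT : shift p t T <= 1 + 3 * delta.
  have /andP[_ h1] := @shift_inv p D t T ltac:(by rewrite t0) pD DT.
  have /andP[h2 _] :=
    @shift_inv p D s T
      ltac:(by rewrite s0 (le_trans sS)// (le_trans St)) pD DT'.
  have h3 := @shift_homol p^-1%g s t T ltac:(by rewrite s0 (le_trans sS)).
  have h4 := @shift_antir p s S T
    ltac:(by rewrite (le_trans s0)//= (le_trans St)).
  lra.
have b0 : shift p^-1%g 0 t <= 1 + delta.
  have h3 := @shift_homol p^-1%g 0 s' t ltac:(by rewrite lexx).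
  have h4 := @shift_antir p^-1%g s' S' t ltac:(by rewrite (le_trans s'0)).
  lra.
move: bT b0; rewrite /shift isom_inv subr0.
have e0t : mdist (c 0) (c t) = t by rewrite rayP// sub0r normrN ger0_norm.
have etT : mdist (c t) (c T) = T - t.
  by rewrite rayP// distrC ger0_norm ?subr_ge0.
have e0T : mdist (c 0) (c T) = T by rewrite rayP// sub0r normrN ger0_norm.
have e1 := metric_sym (c T) (a p (c t)).
have e2 := metric_sym (a p (c t)) (c 0).
have := X_hyp (a p (c t)) (c 0) (c t) (c T).
rewrite /four_point /Num.max; case: ifP => _; lra.
Qed.

End Displacement.

Lemma parabolic_not_cobounded (R : realType) (G : groupType) (X : metricType R)
    (a : isom_action G X) (P : set G) (x0 : X) (D : R) :
  gromov_hyperbolic X -> proper_space X ->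
  properly_discontinuous_on a [set: X] -> parabolic a P ->
  exists x, forall g, D < mdist (a g x) x0.
Proof.
move=> /gromov_hyperbolicP[delta hyp] Xprop pd.
move=> [Psub Pinf [xi Pxi] Pnlox].
apply: contrapT => /forallNP cob.
pose c := ray_of xi.
have Pfix p : P p -> fixes_end a c p.
  by move=> /Pxi; rewrite -[RHS]ray_ofK => /ray_endP.
have PV p : P p -> P p^-1%g.
  by move=> /mem_set Pp; apply: set_mem; exact: (group_closedV Psub).
have Pdis p : exists t0 : R, P p -> 0 <= t0 /\ forall t, t0 <= t ->
    mdist (a p (c t)) (c t) <= 4 * delta + 1.
  have [Pp|nPp] := pselect (P p); last by exists 0.
  have [t0 t00 ht0] := parabolic_displacement hyp (Pfix _ Pp)
    (Pnlox _ Pp) (Pnlox _ (PV _ Pp)).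
  by exists t0.
have {Pdis}[T PT] := choice Pdis.
(* The ball has to contain a translate [a g (c t)], within [D] of [x0], and the images of that
   translate under the conjugates by [g] of the chosen elements of [P]. *)
pose r := D + (4 * delta + 1).
pose K := [set y : X | mdist x0 y <= r].
have Kfin := pd K (@subsetT _ _) (Xprop x0 r).
pose F := [set g : G | [set a g x | x in K] `&` K !=set0].
(* [B] has more elements than [F], while conjugation by [g] will map it injectively into [F]. *)
have [B BP Bcard] := infinite_set_fset (#|` fset_set F|).+1 Pinf.
(* From [t] on, the displacement bound holds for all elements of [B] at once. *)
pose t := \big[Num.max/0]_(p <- enum_fset B) T p.
have tT p : p \in B -> T p <= t.
  by move=> pB; exact: le_bigmax_seq.
have [g gD] : exists g, mdist (a g (c t)) x0 <= D.
  have /existsNP[g /negP] := cob (c t).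
  by rewrite -leNgt => ?; exists g.
have d0 := hyp_delta_ge0 c hyp.
pose B' := [fset (g * p * g^-1)%g | p in B]%fset.
have : (#|` B'| <= #|` fset_set F|)%N.
  apply/fsubset_leq_card/fsubsetP => _ /imfsetP[p /= pB ->].
  rewrite in_fset_set//; apply: mem_set; exists (a (g * p)%g (c t)); split.
    exists (a g (c t)).
      by rewrite /K/= metric_sym /r; lra.
    by rewrite -actM mulgVK.
  rewrite /K/= actM metric_sym.
  apply: le_trans (metric_triangle _ (a g (c t)) _) _.
  rewrite isom_actE addrC lerD//.
  by have [_] := PT p (BP _ pB); apply; exact: tT.
rewrite card_imfset/=; last by move=> p q /= /mulIg /mulgI.
by rewrite leqNgt Bcard.
Qed.

(** * Continuity and concatenation of geodesics in metric spaces *)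

Section MetricTopology.
Context {R : realType}.
Implicit Types X Y : metricType R.

Lemma nonexpansive_continuous X Y (f : X -> Y) :
  (forall x y, mdist (f x) (f y) <= mdist x y) -> continuous f.
Proof.
move=> f1 x; apply/metricType_numDomainType.cvgrPdist_lt => e e0.
apply/metricType_numDomainType.nbhs_mdistP.
by exists e => // y /=; apply: le_lt_trans.
Qed.

Lemma closed_mdist_le X (x : X) (r : R) : closed [set y | mdist x y <= r].
Proof.
rewrite -openC openE => y /=; rewrite /interior => /negP; rewrite -ltNge => ry.
apply/metricType_numDomainType.nbhs_mdistP.
exists (mdist x y - r); rewrite /= ?subr_gt0// => z /= yz.
apply/negP; rewrite -ltNge.
have := metric_triangle x z y; rewrite (metric_sym z y); lra.
Qed.

Definition joined_by_geodesic X (x y : X) :=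
  exists c : R -> X, [/\ c 0 = x, c (mdist x y) = y &
    {in `[0, mdist x y] &, forall s t, mdist (c s) (c t) = `|s - t|}].

Lemma joined_by_geodesicC X (x y : X) :
  joined_by_geodesic x y -> joined_by_geodesic y x.
Proof.
move=> [c [c0 c1 cd]]; exists (fun t => c (mdist x y - t)).
split; [by rewrite subr0| by rewrite metric_sym subrr|].
move=> s t; rewrite (metric_sym y) !in_itv/= => st tt.
rewrite cd ?in_itv/=; [|lra|lra].
by rewrite distrC; congr `|_|; ring.
Qed.

Lemma joined_by_geodesic_trans X (x y z : X) :
  mdist x z = mdist x y + mdist y z ->
  joined_by_geodesic x y -> joined_by_geodesic y z -> joined_by_geodesic x z.
Proof.
move=> xyz [c [c0 c1 cd]] [e [e0 e1 ed]].
have xy0 := mdist_ge0 x y; have yz0 := mdist_ge0 y z.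
exists (fun t => if t <= mdist x y then c t else e (t - mdist x y)).
split; first by rewrite xy0.
  rewrite xyz gerDl; case: ifPn => [yzle|_]; last by rewrite addrC addKr.
  have yz : mdist y z = 0 by lra.
  by rewrite yz addr0 c1; apply: mdist_positivity.
(* The path through [y] gives the upper bound; a shorter distance would bring [x] and [z] closer
   than [mdist x z]. *)
have st_case s t : 0 <= s -> s <= mdist x y -> mdist x y < t ->
    t <= mdist x z -> mdist (c s) (e (t - mdist x y)) = t - s.
  move=> s0 sx tx txz; rewrite xyz in txz.
  have h1 : mdist (c s) y = mdist x y - s.
    by rewrite -{1}c1 cd ?in_itv/= ?s0 ?xy0 ?lexx// distrC ger0_norm// subr_ge0.
  have h2 : mdist y (e (t - mdist x y)) = t - mdist x y.
    rewrite -{1}e0 ed ?in_itv/= ?lexx//; last lra.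
    by rewrite sub0r normrN ger0_norm// subr_ge0 ltW.
  have h3 : mdist x (c s) = s.
    by rewrite -{1}c0 cd ?in_itv/= ?s0 ?xy0 ?lexx// sub0r normrN ger0_norm.
  have h4 : mdist (e (t - mdist x y)) z = mdist x y + mdist y z - t.
    rewrite -{1}e1 ed ?in_itv/= ?lexx ?yz0//; last lra.
    by rewrite distrC ger0_norm; lra.
  have := metric_triangle (c s) y (e (t - mdist x y)).
  have := metric_triangle x (c s) z.
  have := metric_triangle (c s) (e (t - mdist x y)) z.
  lra.
move=> s t; rewrite !in_itv/= => /andP[s0 sz] /andP[t0 tz].
case: (leP s); case: (leP t) => ht hs.
- by rewrite cd ?in_itv/= ?s0 ?t0.
- by rewrite st_case// distrC ger0_norm// subr_ge0; lra.
- by rewrite metric_sym st_case// ger0_norm// subr_ge0; lra.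
- rewrite ed ?in_itv/=; [|lra|lra].
  by congr `|_|; ring.
Qed.

End MetricTopology.

(** * The space with hairs: metric, geodesics, hyperbolicity, properness *)

Lemma line_four_point (R : realFieldType) (s t u v d : R) : 0 <= d ->
  `|s - u| + `|t - v| <= d +
    Num.max (`|s - t| + `|u - v|) (`|t - u| + `|v - s|).
Proof.
have := ler_norm (s - t); have := ler_norm (u - v).
have := ler_norm (t - s); have := ler_norm (v - u).
have := ler_norm (t - u); have := ler_norm (v - s).
have := ler_norm (u - t); have := ler_norm (s - v).
rewrite (distrC v u) (distrC t s) (distrC u t) (distrC s v).
by case: (ler0P (s - u)); case: (ler0P (t - v));
  rewrite /Num.max; case: ifP; lra.
Qed.

(** This is the configuration of three points of one hair, at heights [s], [t], [u], and a fourth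
    point elsewhere, at distance [a] from its foot. *)
Lemma tripod_four_point (R : realFieldType) (s t u a d : R) : 0 <= d ->
  `|s - u| + (t + a) <= d + Num.max (`|s - t| + (u + a)) (`|t - u| + (a + s)).
Proof.
by move=> d0; case: (ler0P (s - u)) => ?; case: (ler0P (s - t)) => ?;
  case: (ler0P (t - u)) => ?; rewrite /Num.max; case: ifP => ?; lra.
Qed.

(* The space [X] with a segment of length [L x] glued by one end at each point
   [x], so that nothing is glued where [L] vanishes; the points of height 0 form
   the copy of [X]. *)
Record comb (R : realType) (X : metricType R) (L : X -> nat) := Comb {
  base : X ;
  height : R ;
  heightP : 0 <= height <= (L base)%:R
}.

HB.instance Definition _ (R : realType) (X : metricType R) (L : X -> nat) :=
  gen_eqMixin (comb L).
HB.instance Definition _ (R : realType) (X : metricType R) (L : X -> nat) :=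
  gen_choiceMixin (comb L).

Section CombMetric.
Context {R : realType} {X : metricType R} (L : X -> nat).
Local Notation C := (comb L).
Implicit Types p q : C.

Lemma height_ge0 p : 0 <= height p.
Proof. by case/andP: (heightP p). Qed.

Lemma comb_eq p q : base p = base q -> height p = height q -> p = q.
Proof.
case: p q => [x s ps] [y t pt] /= xy st; move: xy st ps pt => <- <- ps pt.
by rewrite (bool_irrelevance ps pt).
Qed.

(** The path metric of the glued space: a hair can only be left through its foot. *)
Definition comb_dist p q : R :=
  if base p == base q then `|height p - height q|
  else height p + mdist (base p) (base q) + height q.

Lemma comb_distxx p : comb_dist p p = 0.
Proof. by rewrite /comb_dist eqxx subrr normr0. Qed.

Lemma comb_dist_sym p q : comb_dist p q = comb_dist q p.
Proof.
rewrite /comb_dist eq_sym distrC metric_sym; case: ifP => // _.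
by rewrite -addrA addrC (addrC (mdist _ _)).
Qed.

Lemma comb_dist_eq0 p q : comb_dist p q = 0 -> p = q.
Proof.
rewrite /comb_dist; case: eqVneq => [e /normr0_eq0 /subr0_eq|].
  exact: comb_eq.
rewrite -mdist_gt0 => pq h; exfalso.
by have := height_ge0 p; have := height_ge0 q; lra.
Qed.

Lemma comb_dist_triangle q p r : comb_dist p r <= comb_dist p q + comb_dist q r.
Proof.
rewrite /comb_dist.
have := height_ge0 p; have := height_ge0 q; have := height_ge0 r.
move: (base p) (base q) (base r) (height p) (height q) (height r).
move=> x y z s t u.
have := metric_triangle x y z; have := mdist_ge0 x y; have := mdist_ge0 y z.
have := metric_sym y z; have := metric_sym x y.
case: (eqVneq x z) => xz; case: (eqVneq x y) => xy; case: (eqVneq y z) => yz;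
  subst; rewrite ?mdistxx => *; try (by rewrite eqxx in xz);
  repeat case: ler0P => ?; lra.
Qed.

HB.instance Definition _ := isMetric.Build R C
  comb_distxx comb_dist_eq0 comb_dist_sym comb_dist_triangle.

Lemma comb_mdistE p q : mdist p q = if base p == base q
  then `|height p - height q|
  else height p + mdist (base p) (base q) + height q.
Proof. by []. Qed.

Lemma comb_mdist_same p q : base p = base q ->
  mdist p q = `|height p - height q|.
Proof. by rewrite comb_mdistE => ->; rewrite eqxx. Qed.

Lemma comb_mdist_neq p q : base p <> base q ->
  mdist p q = height p + mdist (base p) (base q) + height q.
Proof. by rewrite comb_mdistE; case: eqVneq. Qed.

Lemma base_nonexpansive p q : mdist (base p) (base q) <= mdist p q.
Proof.
rewrite comb_mdistE; case: eqVneq => [->|_]; first by rewrite mdistxx.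
by have := height_ge0 p; have := height_ge0 q; lra.
Qed.

Lemma comb_mdist_le p q :
  mdist p q <= height p + mdist (base p) (base q) + height q.
Proof.
rewrite comb_mdistE; case: eqVneq => [->|//]; rewrite mdistxx.
by have := height_ge0 p; have := height_ge0 q; case: ler0P; lra.
Qed.

(** Clamping [s] to the length of the hair makes [hair x] a total, nonexpansive function on the
    line. *)
Fact hair_subproof (x : X) (s : R) :
  0 <= Num.min (L x)%:R (Num.max 0 s) <= (L x)%:R.
Proof. by rewrite le_min ler0n le_max lexx/= ge_min lexx. Qed.

Definition hair (x : X) (s : R) : C := Comb (hair_subproof x s).

Lemma height_hair x s : 0 <= s <= (L x)%:R -> height (hair x s) = s.
Proof. by move=> /andP[s0 sL] /=; rewrite (max_idPr s0) (min_idPr sL). Qed.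

Lemma hairK p : hair (base p) (height p) = p.
Proof. by apply: comb_eq; rewrite // height_hair ?heightP. Qed.

Definition core (x : X) : C := hair x 0.

Lemma height_core x : height (core x) = 0.
Proof. by rewrite height_hair// lexx ler0n. Qed.

Lemma coreP p : height p = 0 -> p = core (base p).
Proof. by move=> p0; rewrite -[LHS]hairK p0. Qed.

Lemma mdist_core x y : mdist (core x) (core y) = mdist x y.
Proof.
rewrite comb_mdistE !height_core subrr normr0 addr0 add0r /=.
by case: eqVneq => // ->; rewrite mdistxx.
Qed.

Lemma mdist_core_height p : mdist p (core (base p)) = height p.
Proof.
by rewrite comb_mdist_same// height_core subr0 ger0_norm// height_ge0.
Qed.

Lemma hair_nonexpansive x s t : mdist (hair x s) (hair x t) <= `|s - t|.
Proof.
rewrite comb_mdist_same//=; have := ler0n R (L x); move: (L x)%:R => l l0.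
case: (leP 0 s) => ?; case: (leP 0 t) => ?; case: (leP l _) => ?;
  try case: (leP l _) => ?; do ?[case: ler0P => ?]; lra.
Qed.

Lemma comb_geodesic : geodesic_space X -> geodesic_space C.
Proof.
move=> Xgeo; rewrite /geodesic_space -/(joined_by_geodesic _ _).
have down p : joined_by_geodesic p (core (base p)).
  exists (fun t => hair (base p) (height p - t)); rewrite mdist_core_height.
  rewrite subr0 subrr hairK; split=> // s t; rewrite !in_itv/= => hs ht.
  have /andP[h0 hL] := heightP p.
  rewrite comb_mdist_same// !height_hair; [|lra|lra].
  by rewrite distrC; congr `|_|; ring.
have across x y : joined_by_geodesic (core x) (core y).
  have [c [c0 c1 cd]] := Xgeo x y; exists (core \o c).
  rewrite mdist_core /= c0 c1; split=> // s t hs ht.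
  by rewrite mdist_core cd.
move=> p q; have [pq|/eqP pq] := eqVneq (base p) (base q).
  wlog pq_le : p q pq / height p <= height q => [H|].
    have [/H|/ltW/H] := leP (height p) (height q); first exact.
    by move=> h; apply/joined_by_geodesicC/h.
  have /andP[p0 pL] := heightP p; have /andP[q0 qL] := heightP q.
  exists (fun t => hair (base p) (height p + t)).
  rewrite comb_mdist_same// distrC ger0_norm ?subr_ge0// addr0 hairK.
  rewrite addrC subrK; split=> //; first by rewrite pq hairK.
  move=> s t; rewrite !in_itv/= => hs ht; rewrite pq in pL *.
  rewrite comb_mdist_same// !height_hair; [|lra|lra].
  by congr `|_|; ring.
(* Down one hair, across the core, up the other: the three lengths add up to the distance. *)
apply: (@joined_by_geodesic_trans _ _ _ (core (base p))) => //.
  rewrite mdist_core_height !comb_mdist_neq// height_core; ring.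
apply: (@joined_by_geodesic_trans _ _ _ (core (base q))) => //.
  rewrite (metric_sym (core (base q)) q) mdist_core_height mdist_core.
  rewrite comb_mdist_neq//.
  by rewrite height_core; ring.
exact/joined_by_geodesicC.
Qed.

(** The symmetries of the quadrilateral cut down the cases in which some of the four points share a
    hair. *)
Lemma four_point_rot d p q r o : four_point d p q r o -> four_point d q r o p.
Proof.
rewrite /four_point addrC (metric_sym r p) => /le_trans; apply.
by rewrite maxC (addrC (mdist p q)).
Qed.

Lemma four_point_flip d p q r o : four_point d p q r o -> four_point d p o r q.
Proof.
rewrite /four_point (metric_sym q o) => /le_trans; apply.
by rewrite maxC addrC (metric_sym p o) (metric_sym q p) (metric_sym o r)
  (metric_sym r q) (addrC (mdist o p)) addrC (addrC (mdist r o)).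
Qed.

(** With a third point on the common hair this is the line or tripod inequality. With both [q] and
    [o] elsewhere, the sides all pass through the common foot, and detours through it bound both
    diagonals. *)
Lemma four_point_opposite d p q r o :
  0 <= d -> base p = base r -> four_point d p q r o.
Proof.
move=> d0 pr.
have tripod q' o' : base q' = base p -> base o' <> base p ->
      four_point d p q' r o'.
  move=> qp op; rewrite /four_point (@comb_mdist_same p r)//.
  rewrite (@comb_mdist_same p q')//.
  rewrite (@comb_mdist_same q' r) ?qp// (@comb_mdist_neq q' o')
    ?(@comb_mdist_neq r o') ?(@comb_mdist_neq o' p) ?qp -?pr//;
    [|exact/nesym..].
  rewrite (metric_sym (base o')).
  move: (height p) (height q') (height r) (height o') (mdist _ _) => s t u v m.
  by rewrite (addrC v) -(addrA t) -(addrA u); exact: tripod_four_point.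
have [qp|/eqP qp] := eqVneq (base q) (base p);
  have [op|/eqP op] := eqVneq (base o) (base p).
- rewrite /four_point !comb_mdist_same ?qp ?op//; exact: line_four_point.
- exact: tripod.
- exact/four_point_flip/tripod.
- have h1 := comb_mdist_le q o; have h2 := comb_mdist_le p r.
  rewrite /four_point -[leLHS]add0r lerD// le_max; apply/orP; left.
  have := metric_triangle (base q) (base p) (base o).
  move: h1 h2; rewrite (@comb_mdist_neq p q) ?(@comb_mdist_neq r o) -?pr
    ?mdistxx//;
    [|exact/nesym..].
  rewrite (metric_sym (base q) (base p)); lra.
Qed.

Lemma four_point_adjacent d p q r o :
  0 <= d -> base p = base q -> four_point d p q r o.
Proof.
move=> d0 pq; have [pr|/eqP pr] := eqVneq (base p) (base r).
  exact: four_point_opposite.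
have [qo|/eqP qo] := eqVneq (base q) (base o).
  by do 3 apply: four_point_rot; exact: four_point_opposite.
(* Neither [r] nor [o] is on the hair, so diagonals and these opposite sides all pass through the
   common foot, and their sums coincide. *)
rewrite /four_point -[leLHS]add0r lerD// le_max; apply/orP; right.
have qr : base q <> base r by rewrite -pq.
have po : base o <> base p by rewrite pq; exact/nesym.
rewrite !comb_mdist_neq// (metric_sym (base o)) -pq; lra.
Qed.

(** When the feet are pairwise distinct, the sum of the four heights enters each of the three sums
    of distances and cancels. Otherwise two points share a hair and, after a rotation, one of the
    two previous lemmas applies. *)
Lemma comb_four_point d p q r o : 0 <= d ->
  four_point d (base p) (base q) (base r) (base o) -> four_point d p q r o.
Proof.
move=> d0; have [|/eqP pr] := eqVneq (base p) (base r).
  by move=> *; exact: four_point_opposite.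
have [qo _|/eqP qo] := eqVneq (base q) (base o).
  by do 3 apply: four_point_rot; exact: four_point_opposite.
have [|/eqP pq] := eqVneq (base p) (base q).
  by move=> *; exact: four_point_adjacent.
have [qr _|/eqP qr] := eqVneq (base q) (base r).
  by do 3 apply: four_point_rot; exact: four_point_adjacent.
have [ro _|/eqP ro] := eqVneq (base r) (base o).
  by do 2 apply: four_point_rot; exact: four_point_adjacent.
have [op _|/eqP op] := eqVneq (base o) (base p).
  by do 1 apply: four_point_rot; exact: four_point_adjacent.
rewrite /four_point !comb_mdist_neq//.
by rewrite /Num.max; case: ifP => ?; case: ifP => ?; lra.
Qed.

Lemma comb_hyperbolic : gromov_hyperbolic X -> gromov_hyperbolic C.
Proof.
move=> /gromov_hyperbolicP[d hd]; apply/gromov_hyperbolicP.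
exists (Num.max 0 d) => p q r o; apply: comb_four_point.
  by rewrite le_max lexx.
by apply: le_trans (hd _ _ _ _) _; rewrite lerD2r le_max lexx orbT.
Qed.

Lemma comb_proper :
  (forall x r, finite_set [set y : X | mdist x y <= r /\ (0 < L y)%N]) ->
  proper_space X -> proper_space C.
Proof.
move=> Lfin Xprop p r.
pose F := [set y : X | mdist (base p) y <= r /\ (0 < L y)%N].
(* A ball is covered by a ball of the core and the finitely many hairs whose feet lie in it. *)
pose K := core @` [set y | mdist (base p) y <= r] `|`
  \bigcup_(y in F) (hair y @` [set` `[0, (L y)%:R]]).
apply: (@subclosed_compact _ _ K); first exact: closed_mdist_le.
  apply: compactU.
    apply: continuous_compact; last exact: Xprop.
    apply/continuous_subspaceT/nonexpansive_continuous => x y.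
    by rewrite mdist_core.
  rewrite -bigsetU_fset_set; last exact: Lfin.
  apply: bigsetU_compact => y _.
  apply: continuous_compact; last exact: segment_compact.
  apply: continuous_subspaceT => s.
  apply/metricType_numDomainType.cvgrPdist_lt => e e0; near=> t.
  apply: le_lt_trans (hair_nonexpansive _ _ _) _; near: t.
  exact: (@cvgr_dist_lt _ _ _ _ _ id).
move=> q /= pq; have bpq := le_trans (base_nonexpansive p q) pq.
have [q0|q0] := eqVneq (height q) 0.
  by left; exists (base q) => //; rewrite -coreP.
right; exists (base q); last first.
  by exists (height q); rewrite ?hairK//= in_itv/= heightP.
split=> //; rewrite lt0n; apply/negP => /eqP Lq; have := heightP q.
by rewrite Lq -eq_le eq_sym (negPf q0).
Unshelve. all: by end_near. Qed.

End CombMetric.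

(** * Transport of geometrically finite convergence actions along equivariant homeomorphisms *)

Lemma comp_continuous (S T U : topologicalType) (f : S -> T) (g : T -> U) :
  continuous f -> continuous g -> continuous (g \o f).
Proof.
by move=> fc gc x; apply: continuous_comp; [exact: fc|exact: gc].
Qed.

Lemma pair_continuous (S T U : topologicalType) (f : S -> T) (g : S -> U) :
  continuous f -> continuous g -> continuous (fun x => (f x, g x)).
Proof. by move=> fc gc x; apply: cvg_pair; [exact: fc|exact: gc]. Qed.

Section Conjugacy.
Context {R : realType} {G : groupType} {M N : topologicalType}.
Variables (a : action G M) (b : action G N) (j : M -> N) (k : N -> M).
Hypotheses (jK : cancel j k) (kK : cancel k j).
Hypotheses (j_cont : continuous j) (k_cont : continuous k).
Hypothesis j_equiv : equivariant a b j.

Lemma conjugate_equivariant : equivariant b a k.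
Proof. by move=> g n; rewrite -[in LHS](kK n) -j_equiv jK. Qed.

Lemma conjugate_stabilizer m : stabilizer b (j m) = stabilizer a m.
Proof.
apply/seteqP; split=> g; rewrite /stabilizer /= -j_equiv; last by move->.
exact: (can_inj jK).
Qed.

Lemma conjugate_convergence_action :
  convergence_action R a -> convergence_action R b.
Proof.
move=> [Mcomp [S [f [h [fK hK fc hc]]]] ac apd]; split.
- have -> : [set: N] = j @` [set: M].
    by apply/seteqP; split=> // n _; exists (k n).
  by apply: continuous_compact => //; exact: continuous_subspaceT.
- exists S, (f \o k), (j \o h); split.
  + by move=> n; rewrite /= fK kK.
  + by move=> s; rewrite /= jK hK.
  + exact: comp_continuous.
  + exact: comp_continuous.
- move=> g; have -> : (b g : N -> N) = j \o a g \o k.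
    by apply/funext => n; rewrite /= j_equiv kK.
  exact/(comp_continuous k_cont)/(comp_continuous (ac g)).
- move=> K Kdist Kcomp.
  pose kkk (t : N * N * N) := (k t.1.1, k t.1.2, k t.2).
  have kkk_cont : continuous kkk.
    have fst_c (U V : topologicalType) : continuous (@fst U V).
      by move=> t; exact: cvg_fst.
    have snd_c (U V : topologicalType) : continuous (@snd U V).
      by move=> t; exact: cvg_snd.
    apply: pair_continuous; first apply: pair_continuous.
    + exact: comp_continuous (comp_continuous (@fst_c _ _) (@fst_c _ _)) k_cont.
    + exact: comp_continuous (comp_continuous (@fst_c _ _) (@snd_c _ _)) k_cont.
    + exact: comp_continuous (@snd_c _ _) k_cont.
  have kkk_dist : kkk @` K `<=` @distinct_triples M.
    move=> _ [t /Kdist [/= h1 h2 h3] <-].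
    by split=> /= /(can_inj kK).
  have := apd _ kkk_dist
    (continuous_compact (continuous_subspaceT kkk_cont) Kcomp).
  apply: sub_finite_set => g [_ [[t Kt <-] Kgt]].
  exists (kkk (act_triple b g t)).
  split; last by exists (act_triple b g t).
  exists (kkk t); first by exists t.
  by rewrite /kkk /act_triple /= !conjugate_equivariant.
Qed.

Lemma conjugate_bounded_parabolic m :
  bounded_parabolic_point a m -> bounded_parabolic_point b (j m).
Proof.
rewrite /bounded_parabolic_point conjugate_stabilizer.
move=> [inf [K [Kc Km Kcov]]].
split=> //; exists (j @` K); split.
- by apply: continuous_compact => //; exact: continuous_subspaceT.
- by move=> _ [x Kx <-] /= /(can_inj jK); exact: Km.
- apply/seteqP; split=> [n /= nm|_ [h hm [_ [x Kx <-] <-]]].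
    have : (~` [set m]) (k n) by move=> kn; apply: nm; rewrite -[m]kn kK.
    rewrite Kcov => -[h hm [x Kx hx]]; exists h => //.
    exists (j x); first by exists x.
    by rewrite -j_equiv hx kK.
  rewrite -j_equiv /= => /(can_inj jK) hx.
  have : (~` [set m]) (a h x) by rewrite Kcov; exists h => //; exists x.
  by apply.
Qed.

Lemma conjugate_conical m :
  conical_limit_point a m -> conical_limit_point b (j m).
Proof.
move=> [g [p [q [pq gp gq]]]]; exists g, (j p), (j q); split.
- by move/(can_inj jK).
- have -> : (fun i => b (g i) (j m)) = j \o (fun i => a (g i) m).
    by apply/funext => i; rewrite /= j_equiv.
  by apply: cvg_comp; [exact: gp|exact: j_cont].
- move=> n nm.
  have -> : (fun i => b (g i) n) = j \o (fun i => a (g i) (k n)).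
    by apply/funext => i; rewrite /= j_equiv kK.
  have kn : k n <> m by move=> kn; apply: nm; rewrite -kn kK.
  by apply: cvg_comp; [exact: gq|exact: j_cont].
Qed.

Lemma conjugate_geometrically_finite :
  geometrically_finite_convergence R a -> geometrically_finite_convergence R b.
Proof.
move=> [ca pts]; split; first exact: conjugate_convergence_action.
move=> n; rewrite -[n]kK; have [bp|cl] := pts (k n).
  by left; exact: conjugate_bounded_parabolic.
by right; exact: conjugate_conical.
Qed.

End Conjugacy.

(** * The boundary of the space with hairs *)

Lemma near_le_limf_einf (R : realType) (f : R -> R) (r : R) :
  (\forall t \near +oo, r <= f t) ->
  (r%:E <= limf_einf (fun t => (f t)%:E) +oo%R)%E.
Proof.
move=> rf; rewrite limf_einfE; apply: le_ereal_sup_tmp.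
exists (ereal_inf ((fun t => (f t)%:E) @` [set t | r <= f t])).
  by exists [set t | r <= f t].
by apply: le_ereal_inf_tmp => _ [t /= rt <-]; rewrite lee_fin.
Qed.

(** Eventual values may stay below the lower limit, hence the passage to a smaller [s]. *)
Lemma limf_einf_le_near (R : realType) (f : R -> R) (r s : R) : s < r ->
  (r%:E <= limf_einf (fun t => (f t)%:E) +oo%R)%E ->
  \forall t \near +oo, s <= f t.
Proof.
move=> sr; rewrite limf_einfE => rf.
have : (s%:E < ereal_sup
    [set ereal_inf ((fun t => (f t)%:E) @` V) | V in +oo%R])%E.
  by apply: lt_le_trans rf; rewrite lte_fin.
move=> /ereal_sup_gt [_ [V /= VF <-] sV]; apply: filterS VF => t Vt.
rewrite -lee_fin; apply/ltW/(lt_le_trans sV)/ereal_inf_lbound.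
by exists t.
Qed.

Section CombBoundary.
Context {R : realType} {X : metricType R} (L : X -> nat).
Local Notation C := (comb L).

Lemma mdist_to_core (p : C) (x : X) :
  mdist p (core L x) = height p + mdist (base p) x.
Proof.
have [<-|/eqP px] := eqVneq (base p) x.
  by rewrite mdist_core_height mdistxx addr0.
by rewrite comb_mdist_neq// height_core addr0.
Qed.

(* Hairs are bounded, so a ray that enters one cannot go on: it runs down its
   initial hair at unit speed and never enters another. *)
Lemma comb_ray_height (c : ray C) t : 0 <= t ->
  (base (c t) = base (c 0) /\ height (c t) = height (c 0) - t) \/
  (base (c t) <> base (c 0) /\ height (c t) = 0).
Proof.
move=> t0.
(* At a late time [T] the ray is off the hairs of [c 0] and of [c t], since the time spent between
   two points of one hair is at most its length. *)
have [T tT [bT1 bT0]] : exists2 T : R, t <= T &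
    base (c T) <> base (c t) /\ base (c T) <> base (c 0).
  pose T := t + (L (base (c 0)))%:R + (L (base (c t)))%:R + 1.
  have l0 := ler0n R (L (base (c 0))); have lt := ler0n R (L (base (c t))).
  have /andP[h0 hL0] := heightP (c 0); have /andP[ht hLt] := heightP (c t).
  have /andP[hT hLT] := heightP (c T).
  exists T; first by rewrite /T; lra.
  have T0 : 0 <= T by rewrite /T; lra.
  have tT : t <= T by rewrite /T; lra.
  split=> bT.
    have := rayP c t0 T0; rewrite (comb_mdist_same (esym bT)).
    rewrite distrC (distrC t) (ger0_norm (x := T - t)) ?subr_ge0//.
    rewrite bT in hLT; case: ler0P => _; rewrite /T; lra.
  have := rayP c (lexx 0) T0; rewrite (comb_mdist_same (esym bT)).
  rewrite distrC (distrC 0) subr0 (ger0_norm (x := T))//.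
  rewrite bT in hLT; case: ler0P => _; rewrite /T; lra.
have T0 := le_trans t0 tT.
have h0T := rayP c (lexx 0) T0; have htT := rayP c t0 T0.
have h0t := rayP c (lexx 0) t0.
have ht := height_ge0 (c t); have h0 := height_ge0 (c 0).
move: h0T htT h0t.
rewrite (comb_mdist_neq (nesym bT0)) (comb_mdist_neq (nesym bT1)).
rewrite !sub0r !normrN (distrC t) !ger0_norm ?subr_ge0//.
have [bt|/eqP bt] := eqVneq (base (c t)) (base (c 0)).
  rewrite (comb_mdist_same (esym bt)) bt.
  by case: ler0P => _ h1 h2 h3; left; split=> //; lra.
(* Visiting [c t] on the way from [c 0] to [c T] costs its height twice, which a geodesic cannot
   afford unless it vanishes. *)
rewrite (comb_mdist_neq (nesym bt)) => h1 h2 h3; right; split=> //.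
have := metric_triangle (base (c 0)) (base (c t)) (base (c T)).
lra.
Qed.

Lemma core_ray_subproof (c : ray X) s t : 0 <= s -> 0 <= t ->
  mdist (core L (c s)) (core L (c t)) = `|s - t|.
Proof. by move=> s0 t0; rewrite mdist_core rayP. Qed.

Definition core_ray (c : ray X) : ray C := Ray (core_ray_subproof c).

Definition core_end (xi : boundary X) : boundary C :=
  ray_end (core_ray (ray_of xi)).

Lemma core_endE c : core_end (ray_end c) = ray_end (core_ray c).
Proof.
apply/ray_endP; have /ray_endP[D cD] := ray_ofK (ray_end c).
by exists D => t t0; rewrite mdist_core cD.
Qed.

Lemma core_end_inj : injective core_end.
Proof.
move=> xi eta; rewrite -[xi]ray_ofK -[eta]ray_ofK !core_endE.
move=> /ray_endP[D cD]; apply/ray_endP; exists D => t t0.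
by rewrite -(mdist_core L) cD.
Qed.

(** Cutting off the initial descent, which takes time [height (c 0)], leaves a ray of the core
    asymptotic to [c]. Hence every boundary point comes from [X]. *)
Lemma comb_ray_tail (c : ray C) : exists c1 : ray X,
  [/\ c1 0 = base (c 0),
      forall t, 0 <= t -> c (height (c 0) + t) = core L (c1 t) &
      core_end (ray_end c1) = ray_end c].
Proof.
have s0 := height_ge0 (c 0); set s := height (c 0) in s0 *.
have cs t : 0 <= t -> c (s + t) = core L (base (c (s + t))).
  move=> t0; apply: coreP.
  have := @comb_ray_height c (s + t) (addr_ge0 s0 t0).
  have := height_ge0 (c (s + t)); rewrite -/s => ? [[_ ?]|[_ //]]; lra.
have c1P t t' : 0 <= t -> 0 <= t' ->
    mdist (base (c (s + t))) (base (c (s + t'))) = `|t - t'|.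
  move=> t0 t'0; rewrite -(mdist_core L) -!cs// rayP ?addr_ge0//.
  by congr `|_|; ring.
exists (Ray c1P); split=> /=.
- rewrite addr0; have [[]//|[bs hs]] := comb_ray_height c s0.
  have := rayP c (lexx 0) s0; rewrite comb_mdist_neq; last exact/nesym.
  rewrite sub0r normrN ger0_norm// -/s hs addr0 => bs0.
  by apply/esym/mdist_positivity; lra.
- by move=> t t0; rewrite -cs.
- rewrite core_endE; apply/ray_endP; exists s => t t0 /=.
  rewrite -cs// rayP ?addr_ge0//.
  by rewrite (_ : s + t - t = s) ?ger0_norm//; ring.
Qed.

Lemma core_end_surj eta : exists xi, core_end xi = eta.
Proof.
have [c1 [_ _ cE]] := comb_ray_tail (ray_of eta).
by exists (ray_end c1); rewrite cE ray_ofK.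
Qed.

Lemma shadow_core o xi r eta : shadow o xi r eta ->
  shadow (core L o) (core_end xi) r (core_end eta).
Proof.
move=> [c [c' [c0 c'0 <- <- rE]]]; exists (core_ray c), (core_ray c').
split; rewrite ?core_endE//= ?c0 ?c'0//.
apply: le_trans rE _; rewrite le_eqVlt; apply/orP; left; apply/eqP.
by congr limf_einf; apply/funext => t; rewrite /gromov_product !mdist_core.
Qed.

(** After the descent, the Gromov product at [o] is the product at its foot plus [height o]. The
    further 1 pays for replacing the lower limit by an eventual bound. *)
Lemma core_shadow (o : C) xi (r : R) eta :
  shadow o (core_end xi) r (core_end eta) ->
  shadow (base o) xi (r - height o - 1) eta.
Proof.
move=> [c [c' [c0 c'0 cxi c'eta rE]]].
have [c1 [c10 c1E c1end]] := comb_ray_tail c.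
have [c1' [c1'0 c1'E c1'end]] := comb_ray_tail c'.
exists c1, c1'; split.
- by rewrite c10 c0.
- by rewrite c1'0 c'0.
- by apply: core_end_inj; rewrite c1end.
- by apply: core_end_inj; rewrite c1'end.
apply: near_le_limf_einf.
have [M [_ hM]] : \forall t \near +oo, r - 1 <= gromov_product o (c t) (c' t).
  by apply: limf_einf_le_near rE; rewrite ltrBlDr ltrDl.
exists (Num.max 0 M); split; first exact: num_real.
move=> t; rewrite gt_max => /andP[/ltW t0 Mt].
have := hM (height o + t) ltac:(have := height_ge0 o; lra).
rewrite -{2}c0 c1E// -{2}c'0 c1'E// /gromov_product mdist_core !mdist_to_core.
lra.
Qed.

End CombBoundary.

(** * The action on the space with hairs *)

Section CombAction.
Context {R : realType} {G : groupType} {X : metricType R} (L : X -> nat).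
Variable a : isom_action G X.
Hypothesis L_inv : forall g x, L (a g x) = L x.
Local Notation C := (comb L).

Fact comb_act_subproof g (p : C) : 0 <= height p <= (L (a g (base p)))%:R.
Proof. by rewrite L_inv heightP. Qed.

Definition comb_act g (p : C) : C := Comb (comb_act_subproof g p).

Lemma comb_act1 p : comb_act 1%g p = p.
Proof. by apply: comb_eq; rewrite //= act1. Qed.

Lemma comb_actM g h p : comb_act (g * h)%g p = comb_act g (comb_act h p).
Proof. by apply: comb_eq; rewrite //= actM. Qed.

Lemma act_inj g : injective (a g).
Proof.
by move=> x y xy; rewrite -[x](act1 a) -(mulVg g) actM xy -actM mulVg act1.
Qed.

Lemma comb_act_isom g p q : mdist (comb_act g p) (comb_act g q) = mdist p q.
Proof. by rewrite !comb_mdistE /= (inj_eq (@act_inj g)) isom_actE. Qed.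

Definition comb_action : isom_action G C :=
  @IsomAction R G C (Action comb_act1 comb_actM) comb_act_isom.

Local Notation b := comb_action.

Lemma comb_action_core g x : b g (core L x) = core L (a g x).
Proof. by apply: comb_eq => //; rewrite /= L_inv. Qed.

Lemma core_end_equivariant :
  equivariant (boundary_action a) (boundary_action b) (@core_end R X L).
Proof.
move=> g xi; rewrite -[xi]ray_ofK /= boundary_mapE !core_endE boundary_mapE.
by apply/ray_endP; exists 0 => t t0; rewrite /= -comb_action_core mdistxx.
Qed.

Lemma comb_properly_discontinuous :
  properly_discontinuous_on a [set: X] -> properly_discontinuous_on b [set: C].
Proof.
move=> apd K _ Kc.
have Kb : compact (@base R X L @` K).
  apply: continuous_compact => //; apply: continuous_subspaceT.
  exact/nonexpansive_continuous/base_nonexpansive.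
apply: sub_finite_set (apd _ (@subsetT _ _) Kb).
move=> g [_ [[p Kp <-] Kgp]]; exists (a g (base p)).
by split; [exists (base p) => //; exists p|exists (b g p)].
Qed.

Lemma comb_geometrically_finite :
  geometrically_finite a -> geometrically_finite b.
Proof.
move=> [apd gf]; split; first exact: comb_properly_discontinuous.
have [k kK] := choice (@core_end_surj R X L).
have jK : cancel (@core_end R X L) k.
  by move=> xi; apply: (@core_end_inj _ _ L); rewrite kK.
apply: (conjugate_geometrically_finite jK kK _ _ core_end_equivariant gf).
- apply/continuousP => U; rewrite !boundary_openE => Uo o xi Uxi.
  have [r rU] := Uo (core L o) _ Uxi; exists r => eta.
  by move=> /(@shadow_core R X L) /rU.
- apply/continuousP => U; rewrite !boundary_openE => Uo o xi Uxi.
  (* The larger radius makes up for the loss in [core_shadow]. *)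
  have [r rU] := Uo (base o) _ Uxi; exists (r + height o + 1) => eta.
  rewrite -{1}[xi]kK -{1}[eta]kK => /core_shadow.
  by rewrite (_ : r + height o + 1 - height o - 1 = r) => [/rU//|]; ring.
Qed.

Lemma comb_loxodromic g : loxodromic b g <-> loxodromic a g.
Proof.
split=> [[p [K [c [K1 c0 h]]]]|[x [K [c [K1 c0 h]]]]].
  (* The action preserves heights, so [base] shortens distances within the orbit of [p] by at most
     [2 * height p]. *)
  exists (base p), K, (c + 2 * height p); have hp := height_ge0 p.
  split=> //; first lra.
  move=> m n; have /andP[h1 h2] := h m n.
  have := base_nonexpansive (b (zpow g m) p) (b (zpow g n) p).
  have := comb_mdist_le (b (zpow g m) p) (b (zpow g n) p).
  rewrite /= in h1 h2 *; lra.
exists (core L x), K, c; split=> // m n.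
by rewrite !comb_action_core mdist_core.
Qed.

Lemma comb_parabolic P : parabolic b P <-> parabolic a P.
Proof.
split=> -[Psub Pinf [xi Pxi] Pnlox]; split=> //.
- have [xi' xiE] := core_end_surj xi; exists xi' => g Pg.
  by apply: (@core_end_inj _ _ L); rewrite core_end_equivariant xiE Pxi.
- by move=> g Pg; rewrite -comb_loxodromic; exact: Pnlox.
- by exists (core_end L xi) => g Pg; rewrite -core_end_equivariant Pxi.
- by move=> g Pg; rewrite comb_loxodromic; exact: Pnlox.
Qed.

Lemma comb_maximal_parabolic P :
  maximal_parabolic b P <-> maximal_parabolic a P.
Proof.
split=> -[/comb_parabolic Ppar Pmax]; split=> // Q /comb_parabolic; exact: Pmax.
Qed.

End CombAction.

(** * Separated sets and the choice of the hairs *)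

Lemma compact_finite_net (R : realType) (X : metricType R) (K : set X) (e : R) :
  0 < e -> compact K -> exists D : {fset X},
    forall x, K x -> exists2 d, d \in D & mdist d x < e.
Proof.
move=> e0 /compact_near_coveringP Kcov.
(* Along the filter of finite sets growing under inclusion, the near-covering form of compactness
   yields one finite set that serves all of [K]. *)
pose above (D : {fset X}) : set {fset X} :=
  [set E : {fset X} | {subset D <= E}].
have FF : Filter (filter_from [set: {fset X}] above).
  apply: filter_fromT_filter; first by exists fset0.
  move=> D E; exists (D `|` E)%fset => A DEA.
  by split=> x xD; apply: DEA; rewrite in_fsetU xD ?orbT.
have [|D _ KD] := Kcov {fset X} _
  (fun D x => exists2 d, d \in D & mdist d x < e) FF.
  move=> x Kx; exists ([set y | mdist x y < e], above [fset x]%fset).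
    split; last by exists [fset x]%fset.
    by apply/metricType_numDomainType.nbhs_mdistP; exists e.
  by move=> [y E] [/= xy xE]; exists x => //; apply: xE; rewrite inE.
by exists D => x Kx; exact: (KD D).
Qed.

(** Two points at distance at least 1 cannot both be within 1/2 of the same point of a finite net,
    so the size of the net is a bound. *)
Lemma separated_bound (R : realType) (X : metricType R) (K : set X) :
  compact K -> exists N : nat, forall (m : nat) (y : nat -> X),
    (forall i, (i < m)%N -> K (y i)) ->
    (forall i j, (i < m)%N -> (j < m)%N -> i <> j -> 1 <= mdist (y i) (y j)) ->
    (m <= N)%N.
Proof.
have half0 : 0 < 2^-1 :> R by rewrite invr_gt0.
move=> /(compact_finite_net half0)[D KD].
exists (#|` D|) => m y yK ysep.
have /choice[u uP] : forall i, exists x,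
    (i < m)%N -> x \in D /\ mdist x (y i) < 2^-1.
  move=> i; case: (ltnP i m) => [im|_]; last by exists (y 0).
  by have [x xD xy] := KD _ (yK _ im); exists x.
rewrite -(size_iota 0 m) -(size_map u); apply: uniq_leq_size.
  rewrite map_inj_in_uniq ?iota_uniq// => i j.
  rewrite !mem_iota /= !add0n => im jm uij; apply: contrapT => ij.
  have yij := ysep i j im jm ij.
  have [_ ui] := uP i im; have [_ uj] := uP j jm; rewrite uij in ui.
  have := metric_triangle (y i) (u j) (y j).
  rewrite (metric_sym (y i) (u j)); lra.
by move=> z /mapP[i]; rewrite mem_iota /= add0n => im ->; have [] := uP i im.
Qed.

Lemma geodesic_many_points (R : realType) (X : metricType R) (x x0 : X)
    (m : nat) :
  geodesic_space X -> 1 <= mdist x x0 -> exists q : nat -> X,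
    (forall i, (i < m)%N -> mdist x (q i) <= 1) /\
    (forall i j, (i < m)%N -> (j < m)%N -> q i = q j -> i = j).
Proof.
move=> Xgeo d1; have [c [c0 _ cd]] := Xgeo x x0.
have in01 i : (i < m)%N -> 0 <= i%:R / m%:R :> R /\ i%:R / m%:R <= 1 :> R.
  move=> im; have m0 : 0 < m%:R :> R by rewrite ltr0n (leq_ltn_trans _ im).
  by split; rewrite ?divr_ge0// ler_pdivrMr// mul1r ler_nat ltnW.
(* Evenly spaced points on the first unit of a geodesic to [x0], which is long enough for this. *)
exists (fun i => c (i%:R / m%:R)); split=> [i im|i j im jm qij].
  have [i0 i1] := in01 i im.
  rewrite -{1}c0 cd ?in_itv/= ?lexx ?i0 ?(le_trans i1)// ?(le_trans ler01)//.
  by rewrite sub0r normrN ger0_norm.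
have [i0 i1] := in01 i im; have [j0 j1] := in01 j jm.
have := cd (i%:R / m%:R) (j%:R / m%:R).
rewrite !in_itv/= i0 j0 (le_trans i1)// (le_trans j1)// => /(_ isT isT).
rewrite qij mdistxx => /esym/normr0_eq0/subr0_eq.
have m0 : m%:R != 0 :> R by rewrite pnatr_eq0 -lt0n (leq_ltn_trans _ im).
by move=> /(mulIf (invr_neq0 m0)) /eqP; rewrite eqr_nat => /eqP.
Qed.

Section Depth.
Context {R : realType} {G : groupType} {X : metricType R}.
Variables (a : isom_action G X) (x0 : X).

Fact depth_subproof x :
  exists n : nat, `[< exists g, mdist (a g x) x0 <= n%:R >].
Proof.
exists (Num.truncn (mdist x x0)).+1; apply/asboolP; exists 1%g.
by rewrite act1 ltW// truncnS_gt.
Qed.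

(* The distance from [x] to the orbit of [x0], rounded up. *)
Definition depth x : nat := ex_minn (depth_subproof x).

Lemma depth_act g x : depth (a g x) = depth x.
Proof.
rewrite /depth; apply: eq_ex_minn => n; apply/asboolP/asboolP => -[h hx].
  by exists (h * g)%g; rewrite actM.
by exists (h * g^-1)%g; rewrite -actM mulgVK.
Qed.

Lemma depth_gt n x : (forall g, n%:R < mdist (a g x) x0) -> (n < depth x)%N.
Proof.
move=> far; rewrite /depth; case: ex_minnP => k /asboolP[g gk] _.
by rewrite -(ltr_nat R) (lt_le_trans (far g)).
Qed.

Lemma depth_le n x : mdist x x0 <= n%:R -> (depth x <= n)%N.
Proof.
move=> xn; rewrite /depth; case: ex_minnP => k _; apply.
by apply/asboolP; exists 1%g; rewrite act1.
Qed.

Lemma depth_le_mdist x : (depth x)%:R <= mdist x x0 + 1.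
Proof.
have : (depth x <= (Num.truncn (mdist x x0)).+1)%N.
  by apply: depth_le; rewrite ltW// truncnS_gt.
rewrite -(ler_nat R) => /le_trans; apply.
by rewrite -natr1 lerD2r truncn_le// mdist_ge0.
Qed.

Lemma deep_hairs : geodesic_space X -> proper_space X ->
  properly_discontinuous_on a [set: X] ->
  (forall D : R, exists x, forall g, D < mdist (a g x) x0) ->
  exists L : X -> nat, [/\ forall g x, L (a g x) = L x,
    forall x r, finite_set [set y : X | mdist x y <= r /\ (0 < L y)%N] &
    forall f : X -> comb L, ~ quasi_isometry f].
Proof.
move=> Xgeo Xprop apd deep.
have /choice[x xdeep] : forall n : nat, exists x, forall g,
    n%:R + 1 < mdist (a g x) x0 by move=> n; exact: deep.
(* The hairs are chosen before [f], so [n] stands in for its constants. The remaining terms bound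
   the distance from [core L x0] to a tip: the foot is within [mdist x0 (x n) + 1] of [x0], and the
   hair is longer than the distance from its foot to [x0] by at most 1. *)
pose r n : R := n%:R * (n%:R + 2 * mdist x0 (x n) + 3).
have /choice[N NP] : forall n, exists N : nat,
    forall (m : nat) (y : nat -> X),
    (forall i, (i < m)%N -> mdist x0 (y i) <= r n) ->
    (forall i j, (i < m)%N -> (j < m)%N -> i <> j -> 1 <= mdist (y i) (y j)) ->
    (m <= N)%N.
  by move=> n; exact: separated_bound (Xprop x0 (r n)).
have /choice[q qP] : forall n, exists q : nat -> X,
    (forall i, (i < (N n).+1)%N -> mdist (x n) (q i) <= 1) /\
    (forall i j, (i < (N n).+1)%N -> (j < (N n).+1)%N -> q i = q j -> i = j).
  move=> n; apply: (geodesic_many_points _ Xgeo (x0 := x0)).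
  have := xdeep n 1%g; rewrite act1; have := ler0n R n; lra.
have qdeep n i : (i < (N n).+1)%N -> (n < depth (q n i))%N.
  move=> iN; apply: depth_gt => g; have [/(_ i iN) qx _] := qP n.
  have := metric_triangle (a g (x n)) (a g (q n i)) x0.
  by rewrite isom_actE; have := xdeep n g; lra.
pose S : set X := [set y | exists n i g, (i < (N n).+1)%N /\ y = a g (q n i)].
(* Taking [depth] as length makes [L] invariant, gives the hair at [q n i] length more than [n], and
   still keeps its tip at a controlled distance from [x0]. *)
pose L y := if `[< S y >] then depth y else 0%N.
have Lq n i : (i < (N n).+1)%N -> L (q n i) = depth (q n i).
  move=> iN; rewrite /L; case: asboolP => // -[].
  by exists n, i, 1%g; rewrite act1.
exists L; split.
- move=> g y; rewrite /L depth_act; congr (if _ then _ else _).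
  apply/asboolP/asboolP => -[n [i [h [iN hE]]]]; exists n, i.
    by exists (g^-1 * h)%g; split=> //; rewrite actM -hE -actM mulVg act1.
  by exists (g * h)%g; split=> //; rewrite actM hE.
(* A foot near [z] has depth at most [M], which leaves finitely many indices [n] and [i]. For each
   of them, proper discontinuity on a ball containing [q n i] and all such feet leaves finitely many
   translates. *)
- move=> z s; pose M := (Num.truncn (mdist x0 z + s)).+1.
  pose K n i :=
    [set y | mdist x0 y <= Num.max (mdist x0 z + s) (mdist x0 (q n i))].
  pose F n i := [set g : G | (a g @` K n i) `&` K n i !=set0].
  apply: (@sub_finite_set _ _ (\bigcup_(n in `I_M) \bigcup_(i in `I_(N n).+1)
      ((fun g => a g (q n i)) @` F n i))).
    move=> y /= [zy]; rewrite /L; case: asboolP => // -[n [i [g [iN yE]]]] _.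
    have x0y : mdist x0 y <= mdist x0 z + s.
      by rewrite (le_trans (metric_triangle _ z _))// lerD2l.
    exists n => /=.
      apply: (leq_trans (qdeep n i iN)); rewrite -(depth_act g) -yE.
      by apply: depth_le; rewrite metric_sym (le_trans x0y)// ltW// truncnS_gt.
    exists i => //; exists g; last by [].
    exists y; split; last by rewrite /K/= le_max x0y.
    by exists (q n i); [rewrite /K/= le_max lexx orbT|].
  apply: bigcup_finite => [|n _]; first exact: finite_II.
  apply: bigcup_finite => [|i _]; first exact: finite_II.
  by apply/finite_image/apd => //; exact: Xprop.
move=> f [[K [c [K1 c0 fqi]]] [D fD]].
have /choice[pre preP] := fD.
have D0 : 0 <= D by apply: le_trans (preP (f x0)); exact: mdist_ge0.
pose e := mdist (core L x0) (f x0).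
have e0 : 0 <= e := mdist_ge0 _ _.
(* Large enough for both uses: the preimages of the tips lie in the ball of radius [r n], and they
   are 1-separated. *)
pose n := (Num.truncn (K + c + e + 2 * D)).+1.
have nlarge : K + c + e + 2 * D <= n%:R by rewrite ltW// truncnS_gt.
pose tip i : comb L := hair L (q n i) (L (q n i))%:R.
have tip_height i : height (tip i) = (L (q n i))%:R.
  by rewrite height_hair// ler0n lexx.
have : ((N n).+1 <= N n)%N; last by rewrite ltnn.
apply: (NP n _ (fun i => pre (tip i))) => [i iN|i j iN jN ij].
  have /andP[+ _] := fqi x0 (pre (tip i)).
  rewrite lerBlDr ler_pdivrMl ?(lt_le_trans ltr01)// => h.
  apply: le_trans h _; rewrite /r ler_pM ?mdist_ge0//; [lra| |lra|].
    by rewrite addr_ge0 ?mdist_ge0.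
  have := metric_triangle (f x0) (core L x0) (f (pre (tip i))).
  have := metric_triangle (core L x0) (tip i) (f (pre (tip i))).
  rewrite (metric_sym (tip i)) (metric_sym (f x0) (core L x0)) -/e.
  rewrite (metric_sym (core L x0) (tip i)) mdist_to_core tip_height Lq//=.
  have := preP (tip i); have := depth_le_mdist (q n i).
  have [/(_ i iN) qx _] := qP n; move: qx.
  have := metric_triangle x0 (x n) (q n i); rewrite (metric_sym (q n i) x0).
  lra.
have /andP[_ +] := fqi (pre (tip i)) (pre (tip j)) => h.
have qij : q n i <> q n j by move=> qq; apply: ij; have [_] := qP n; apply.
(* Going from tip to tip means running through two hairs longer than [n]; this exceeds the errors
   [c + 2 * D] by at least [K]. *)
have tij : mdist (tip i) (tip j) >= 2 * n%:R.
  rewrite (@comb_mdist_neq _ _ _ (tip i) (tip j) qij) !tip_height.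
  rewrite !Lq//; have := mdist_ge0 (q n i) (q n j).
  have := qdeep n i iN; have := qdeep n j jN; rewrite -!(ltr_nat R) /=; lra.
have := metric_triangle (tip i) (f (pre (tip i))) (tip j).
have := metric_triangle (f (pre (tip i))) (f (pre (tip j))) (tip j).
rewrite (metric_sym (tip i) (f _)).
have := preP (tip i); have := preP (tip j).
move=> h1 h2 h3 h4.
have Kd : K <= K * mdist (pre (tip i)) (pre (tip j)) by lra.
by rewrite -(ler_pM2l (lt_le_trans ltr01 K1)) mulr1.
Qed.

End Depth.

Theorem theorem2 (R : realType) (G : groupType) (HH : set (set G)) :
  relatively_hyperbolic R HH ->
  HH !=set0 ->
  (forall H, HH H -> infinite_set H) ->
  exists (X1 X2 : metricType R)
         (a1 : isom_action G X1) (a2 : isom_action G X2),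
    [/\ proper_hyperbolic_space X1 /\ proper_hyperbolic_space X2,
        geometrically_finite a1 /\ HH = [set P | maximal_parabolic a1 P],
        geometrically_finite a2 /\ HH = [set P | maximal_parabolic a2 P] &
        ~ exists f : X1 -> X2, quasi_isometry f /\ equivariant a1 a2 f].
Proof.
move=> [X [a [Xph agf HHE _]]] [P HHP] _.
have [Xgeo Xhyp Xprop] := Xph; have [apd _] := agf.
have [Ppar _] : maximal_parabolic a P by rewrite HHE in HHP.
(* A peripheral subgroup fixes a boundary point, and a ray to that point supplies a base point of
   [X]. *)
have [_ _ [xi _] _] := Ppar; pose x0 := ray_of xi 0.
have [L [Linv Lfin Lnqi]] := deep_hairs Xgeo Xprop apd
  (fun D => parabolic_not_cobounded x0 D Xhyp Xprop apd Ppar).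
exists X, (comb L), a, (comb_action Linv); split.
- split=> //; split.
  + exact: comb_geodesic.
  + exact: comb_hyperbolic.
  + exact: comb_proper.
- by split.
- split; first exact: comb_geometrically_finite.
  by rewrite HHE; apply/seteqP; split=> Q /=; rewrite comb_maximal_parabolic.
- by move=> [f [fqi _]]; exact: (Lnqi f).
Qed.
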